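(* Let $\mathcal D\subset\mathbb R^d$ be a bounded domain, let $\boldsymbol x_1,\dots,\boldsymbol x_m\in\mathcal D$ be pairwise distinct, and let $p_1,\dots,p_l:\mathcal D\to\mathbb R$ be continuous functions, linearly independent on $\mathcal D$, with linear span $\mathcal P_l$. Assume that $1\in\mathcal P_l$ (the constant function), that $1\le l\le m$, that the $m\times l$ matrix $E=(p_j(\boldsymbol x_i))_{1\le i\le m,\,1\le j\le l}$ satisfies $\operatorname{rank}(E^t)=l$, and that the inverse weight function $w:[0,\infty)\to[0,\infty)$ is smooth. Let $\boldsymbol x\in\mathcal D$ with $\boldsymbol x\ne\boldsymbol x_i$ for all $i=1,\dots,m$, and put $D=2\,\mathrm{diag}\big(w(\|\boldsymbol x-\boldsymbol x_1\|),\dots,w(\|\boldsymbol x-\boldsymbol x_m\|)\big)$. Let $$A_1=D^{-1}E\left(E^tD^{-1}E\right)^{-1}E^t .$$ Then $$\|A_1D^{-1}\|\le\frac{1}{\lambda_{\min}(D)},$$ $$\sigma_{\max}(A_1)\,\sigma_{\min}(D^{-1})\le\sigma_{\max}(A_1D^{-1}),$$ $$1\le\|A_1\|\le\sqrt{\frac{\sigma_{\max}(D)}{\sigma_{\min}(D)}} .$$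
   Context: For vectors $\|\cdot\|$ is the Euclidean norm, and for matrices it is the induced operator (spectral) 2-norm; $^t$ denotes transpose; $\lambda_{\min}$ is the smallest eigenvalue of a real symmetric matrix; $\sigma_{\max}$ and $\sigma_{\min}$ denote the largest and smallest singular values. The function $w$ comes from a weight function $W$, strictly positive on $(0,\infty)$, via $w(r)=1/W(r)$ if $r>0$, or if $r=0$ and $W(0)<\infty$; and $w(0)=0$ if $W(0)=\infty$. In particular $w(r)>0$ for $r>0$, so $D$ is invertible. Under the stated hypotheses $E^tD^{-1}E$ is non-singular, so $A_1$ is well defined. *)

(* Defs.v *)
From HB Require Import structures.
From mathcomp Require Import all_boot all_order all_algebra.
From mathcomp Require Import all_classical all_reals all_analysis.
Set Implicit Arguments.
Unset Strict Implicit.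
Unset Printing Implicit Defensive.
Import Order.TTheory GRing.Theory Num.Theory.
Import numFieldNormedType.Exports.
Local Open Scope classical_set_scope.
Local Open Scope ring_scope.

(* The library norm `|v| on matrices is the sup norm, hence this definition. *)
Definition enorm (R : realType) (n : nat) (v : 'cV[R]_n) : R :=
  Num.sqrt (\sum_(i < n) v i 0 ^+ 2).

Definition opnorm (R : realType) (m n : nat) (A : 'M[R]_(m, n)) : R :=
  sup [set enorm (A *m v) | v in [set v : 'cV[R]_n | enorm v <= 1]].

(* The spectrum of a real symmetric matrix of positive size is finite and
   nonempty, so the inf (resp. sup) below is a minimum (resp. maximum). *)
Definition lambda_min (R : realType) (n : nat) (A : 'M[R]_n) : R :=
  inf [set a | eigenvalue A a].

Definition singular_values (R : realType) (n : nat) (A : 'M[R]_n) : set R :=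
  [set Num.sqrt a | a in [set a | eigenvalue (A^T *m A) a]].

Definition sigma_max (R : realType) (n : nat) (A : 'M[R]_n) : R :=
  sup (singular_values A).

Definition sigma_min (R : realType) (n : nat) (A : 'M[R]_n) : R :=
  inf (singular_values A).

(* Boundedness for the sup norm is boundedness for the Euclidean norm. *)
Definition bounded_domain (R : realType) (d : nat) (Omega : set 'cV[R]_d) :=
  [/\ Omega !=set0, open Omega, connected Omega & bounded_set Omega].

Definition lin_indep_on (R : realType) (T : Type) (l : nat)
    (Omega : set T) (p : 'I_l -> T -> R) : Prop :=
  forall c : 'I_l -> R,
    (forall y, Omega y -> \sum_(j < l) c j * p j y = 0) -> forall j, c j = 0.

Definition in_span_on (R : realType) (T : Type) (l : nat)
    (Omega : set T) (p : 'I_l -> T -> R) (f : T -> R) : Prop :=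
  exists c : 'I_l -> R, forall y, Omega y -> f y = \sum_(j < l) c j * p j y.

(* A weight is real and positive on ]0, +oo[.  Its value at 0 may be +oo; when
   finite, it has to be positive for 1 / W 0 to be a nonnegative real.  Only
   the restriction of W to [0, +oo[ matters. *)
Definition weight_function (R : realType) (W : R -> \bar R) : Prop :=
  (forall r : R, 0 < r -> (0 < W r < +oo)%E) /\ (0 < W 0%R)%E.

Definition inverse_weight (R : realType) (W : R -> \bar R) (r : R) : R :=
  if (0 < r) || (r == 0) && (W 0%R < +oo)%E then (fine (W r))^-1 else 0.

(* f has derivatives f = g 0, g 1, g 2, ... of all orders on [0, +oo[: the
   difference quotients are restricted to [0, +oo[, hence one-sided at 0. *)
Definition smooth_nonneg (R : realType) (f : R -> R) : Prop :=
  exists g : nat -> R -> R,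
    (forall r : R, 0 <= r -> g 0%N r = f r) /\
    (forall (n : nat) (r : R), 0 <= r ->
       (s - r)^-1 * (g n s - g n r)
         @[s --> within [set s : R | 0 <= s] r^'] --> g n.+1 r).

Definition sample_mx (R : realType) (d m l : nat)
    (p : 'I_l -> 'cV[R]_d -> R) (xs : 'I_m -> 'cV[R]_d) : 'M[R]_(m, l) :=
  \matrix_(i < m, j < l) p j (xs i).

Definition weight_mx (R : realType) (d m : nat) (w : R -> R)
    (xs : 'I_m -> 'cV[R]_d) (x : 'cV[R]_d) : 'M[R]_m :=
  2 *: diag_mx (\row_(i < m) w (enorm (x - xs i))).

Definition mls_mx (R : realType) (m l : nat)
    (D : 'M[R]_m) (E : 'M[R]_(m, l)) : 'M[R]_m :=
  invmx D *m E *m invmx (E^T *m invmx D *m E) *m E^T.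

(* Main.v *)
(* A_1 is idempotent and D A_1 is symmetric: A_1 is the orthogonal projection
   onto its range for the scalar product <u, D v>.  For y = A_1 D^-1 v this
   gives <y, D y> = <v, y>, hence lambda_min(D) |y| <= |v|; for y = A_1 v it
   gives <y, D y> <= <v, D v>, hence the upper bound on |A_1|.  The lower bound
   is |A_1| <= |A_1|^2 with A_1 <> 0.  The middle inequality follows from
   sigma_max = operator norm and |D v| <= sigma_max(D) |v|. *)
Require Import Defs.
From HB Require Import structures.
From mathcomp Require Import all_boot all_order all_algebra.
From mathcomp Require Import all_classical all_reals all_analysis.
From mathcomp Require Import ring.
Set Implicit Arguments.
Unset Strict Implicit.
Unset Printing Implicit Defensive.
Import Order.TTheory GRing.Theory Num.Theory.
Import numFieldNormedType.Exports.
Local Open Scope classical_set_scope.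
Local Open Scope ring_scope.


(** * Euclidean scalar product and the Cauchy-Schwarz inequality *)

Section EuclideanNorm.
Variable R : realType.

(** Encoded as a matrix product rather than a sum, so that moving a matrix to the other argument is
    plain associativity. *)
Definition dotv n (u v : 'cV[R]_n) : R := (u^T *m v) 0 0.

Lemma dotvE n (u v : 'cV[R]_n) : dotv u v = \sum_i u i 0 * v i 0.
Proof. by rewrite /dotv mxE; apply: eq_bigr => i _; rewrite mxE. Qed.

Lemma dotvC n (u v : 'cV[R]_n) : dotv u v = dotv v u.
Proof. by rewrite !dotvE; apply: eq_bigr => i _; rewrite mulrC. Qed.

Lemma dotvDr n (u v w : 'cV[R]_n) : dotv u (v + w) = dotv u v + dotv u w.
Proof. by rewrite /dotv mulmxDr mxE. Qed.

Lemma dotvZr n a (u v : 'cV[R]_n) : dotv u (a *: v) = a * dotv u v.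
Proof. by rewrite /dotv -scalemxAr mxE. Qed.

Lemma dotvNr n (u v : 'cV[R]_n) : dotv u (- v) = - dotv u v.
Proof. by rewrite -scaleN1r dotvZr mulN1r. Qed.

Lemma dotvDl n (u v w : 'cV[R]_n) : dotv (v + w) u = dotv v u + dotv w u.
Proof. by rewrite dotvC dotvDr !(dotvC u). Qed.

Lemma dotvBl n (u v w : 'cV[R]_n) : dotv (v - w) u = dotv v u - dotv w u.
Proof. by rewrite dotvC dotvDr dotvNr !(dotvC u). Qed.

Lemma dotvZl n a (u v : 'cV[R]_n) : dotv (a *: u) v = a * dotv u v.
Proof. by rewrite dotvC dotvZr dotvC. Qed.

Lemma dotv_mull m n (A : 'M[R]_(m, n)) u v :
  dotv (A *m u) v = dotv u (A^T *m v).
Proof. by rewrite /dotv trmx_mul mulmxA. Qed.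

Lemma dotv_ge0 n (v : 'cV[R]_n) : 0 <= dotv v v.
Proof. by rewrite dotvE; apply: sumr_ge0 => i _; rewrite -expr2 sqr_ge0. Qed.

Lemma dotv_eq0 n (v : 'cV[R]_n) : (dotv v v == 0) = (v == 0).
Proof.
apply/eqP/eqP => [|->]; last by rewrite /dotv mulmx0 mxE.
rewrite dotvE => /eqP; rewrite psumr_eq0 => [/allP v0|i _]; last first.
  by rewrite -expr2 sqr_ge0.
apply/matrixP => i j; rewrite ord1 mxE; apply/eqP.
by have := v0 i (mem_index_enum _); rewrite mulf_eq0 orbb.
Qed.

Lemma enormE n (v : 'cV[R]_n) : enorm v = Num.sqrt (dotv v v).
Proof. by rewrite dotvE. Qed.

Lemma enorm_ge0 n (v : 'cV[R]_n) : 0 <= enorm v.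
Proof. exact: sqrtr_ge0. Qed.

Lemma sqr_enorm n (v : 'cV[R]_n) : enorm v ^+ 2 = dotv v v.
Proof. by rewrite enormE sqr_sqrtr ?dotv_ge0. Qed.

Lemma enorm_eq0 n (v : 'cV[R]_n) : (enorm v == 0) = (v == 0).
Proof. by rewrite -dotv_eq0 -sqr_enorm sqrf_eq0. Qed.

Lemma enormZ n a (v : 'cV[R]_n) : enorm (a *: v) = `|a| * enorm v.
Proof.
by rewrite !enormE dotvZl dotvZr mulrA -expr2 sqrtrM ?sqr_ge0// sqrtr_sqr.
Qed.

Lemma enorm0 n : enorm (0 : 'cV[R]_n) = 0.
Proof. by apply/eqP; rewrite enorm_eq0. Qed.

Lemma enorm_delta n (i : 'I_n) : enorm (delta_mx i 0 : 'cV[R]_n) = 1.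
Proof.
rewrite enormE dotvE (bigD1 i)//= big1 ?addr0 => [|j ji]; last first.
  by rewrite mxE (negbTE ji) mul0r.
by rewrite mxE !eqxx mul1r sqrtr1.
Qed.

(** The quadratic form of [B] is nonnegative at every [s *: u + t *: v]; suitable [s] and [t] give
    the discriminant inequality. Since [B] is only semidefinite, the value at [v] may vanish for
    nonzero [v]. *)
Lemma cauchy_schwarz_psd n (B : 'M[R]_n) (u v : 'cV[R]_n) :
  B^T = B -> (forall w, 0 <= dotv w (B *m w)) ->
  dotv u (B *m v) ^+ 2 <= dotv u (B *m u) * dotv v (B *m v).
Proof.
move=> Bsym Bpsd.
have Bvu : dotv v (B *m u) = dotv u (B *m v).
  by rewrite dotvC dotv_mull Bsym.
have quad s t : 0 <= s ^+ 2 * dotv u (B *m u) + 2 * s * t * dotv u (B *m v)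
                     + t ^+ 2 * dotv v (B *m v).
  have := Bpsd (s *: u + t *: v).
  rewrite mulmxDr !dotvDl !dotvDr -!scalemxAr !dotvZl !dotvZr Bvu.
  by move/le_trans; apply; rewrite le_eqVlt; apply/orP; left; apply/eqP; ring.
move: (dotv u (B *m u)) (dotv u (B *m v)) (dotv v (B *m v)) (Bpsd v) quad.
move=> a b c c0 quad.
rewrite le_eqVlt in c0; case/orP: c0 => [/eqP c0|c0]; first subst c.
  have [->|b0] := eqVneq b 0; first by rewrite expr0n mulr0.
  (* With [c = 0] and [s = 1] the expression is affine in [t] with slope [2 * b]; this [t] gives it
     the value -1, so [b] must vanish. *)
  have := quad 1 (- (a + 1) / (2 * b)).
  have -> : 1 ^+ 2 * a + 2 * 1 * (- (a + 1) / (2 * b)) * b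
      + (- (a + 1) / (2 * b)) ^+ 2 * 0 = - 1 by field.
  by rewrite oppr_ge0 ler10.
have := quad c (- b).
have -> : c ^+ 2 * a + 2 * c * - b * b + (- b) ^+ 2 * c = c * (a * c - b ^+ 2).
  by ring.
by rewrite pmulr_rge0// subr_ge0.
Qed.

Lemma cauchy_schwarz n (u v : 'cV[R]_n) : dotv u v <= enorm u * enorm v.
Proof.
rewrite (le_trans (ler_norm _))// -ler_sqr ?nnegrE ?mulr_ge0 ?enorm_ge0//.
rewrite real_normK ?num_real// exprMn !sqr_enorm.
have := @cauchy_schwarz_psd n 1%:M u v (trmx1 _ _).
by rewrite !mul1mx; apply => w; rewrite mul1mx dotv_ge0.
Qed.

(** * Operator norm and its identification with the largest singular value *)

Lemma enorm_mulmx_bounded m n (A : 'M[R]_(m, n)) :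
  exists2 K : R, 0 < K & forall v, enorm (A *m v) <= K * enorm v.
Proof.
(* [F] is the squared Frobenius norm of [A]; Cauchy-Schwarz is applied row by row. The added 1 keeps
   the constant positive even when [A] is zero. *)
pose F := \sum_i dotv (row i A)^T (row i A)^T.
have F0 : 0 <= F by apply: sumr_ge0 => i _; exact: dotv_ge0.
exists (Num.sqrt F + 1) => [|v]; first by rewrite ltr_wpDl ?sqrtr_ge0.
apply: (@le_trans _ _ (Num.sqrt F * enorm v)); last first.
  by rewrite ler_wpM2r ?enorm_ge0// lerDl.
rewrite -ler_sqr ?nnegrE ?mulr_ge0 ?enorm_ge0 ?sqrtr_ge0//.
rewrite exprMn (sqr_sqrtr F0) sqr_enorm dotvE mulr_suml; apply: ler_sum => i _.
have -> : (A *m v) i 0 = dotv (row i A)^T v.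
  by rewrite dotvE mxE; apply: eq_bigr => j _; rewrite !mxE.
rewrite -expr2 -real_normK ?num_real// -!sqr_enorm -exprMn.
rewrite ler_sqr ?nnegrE ?mulr_ge0 ?enorm_ge0// ler_norml cauchy_schwarz andbT.
rewrite lerNl -dotvNr (le_trans (cauchy_schwarz _ _))//.
by rewrite -scaleN1r enormZ normrN1 mul1r.
Qed.

(** A real [sup] has its expected properties only on a nonempty set bounded above; the bounds on
    [opnorm] rest on this. *)
Lemma opnorm_has_sup m n (A : 'M[R]_(m, n)) :
  has_sup [set enorm (A *m v) | v in [set v : 'cV[R]_n | enorm v <= 1]].
Proof.
split; first by exists (enorm (A *m 0)), 0 => //=; rewrite enorm0 ler01.
have [K K0 AK] := enorm_mulmx_bounded A.
exists K => _ [v /= v1 <-]; rewrite (le_trans (AK v))//.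
by rewrite -[leRHS]mulr1 ler_pM2l.
Qed.

Lemma enorm_mulmx m n (A : 'M[R]_(m, n)) v :
  enorm (A *m v) <= opnorm A * enorm v.
Proof.
have [->|v0] := eqVneq v 0; first by rewrite mulmx0 !enorm0 mulr0.
have nv : 0 < enorm v by rewrite lt_neqAle enorm_ge0 eq_sym enorm_eq0 v0.
rewrite -ler_pdivrMr// mulrC -[_^-1]ger0_norm ?invr_ge0 ?enorm_ge0//.
rewrite -enormZ scalemxAr; apply: ub_le_sup; first exact: (opnorm_has_sup A).2.
exists ((enorm v)^-1 *: v) => //=.
by rewrite enormZ ger0_norm ?invr_ge0 ?enorm_ge0// mulVf ?gt_eqF.
Qed.

Lemma opnorm_ge0 m n (A : 'M[R]_(m, n)) : 0 <= opnorm A.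
Proof.
apply: ub_le_sup; first exact: (opnorm_has_sup A).2.
by exists 0 => /=; rewrite ?mulmx0 enorm0 ?ler01.
Qed.

Lemma opnorm_le m n (A : 'M[R]_(m, n)) K : 0 <= K ->
  (forall v, enorm (A *m v) <= K * enorm v) -> opnorm A <= K.
Proof.
move=> K0 AK; apply: ge_sup; first exact: (opnorm_has_sup A).1.
move=> _ [v /= v1 <-]; rewrite (le_trans (AK v))//.
by rewrite -[leRHS]mulr1 ler_wpM2l.
Qed.

Lemma opnorm_mulmx m n q (A : 'M[R]_(m, n)) (B : 'M[R]_(n, q)) :
  opnorm (A *m B) <= opnorm A * opnorm B.
Proof.
apply: opnorm_le => [|v]; first by rewrite mulr_ge0 ?opnorm_ge0.
rewrite -mulmxA (le_trans (enorm_mulmx _ _))// -mulrA ler_wpM2l ?opnorm_ge0//.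
exact: enorm_mulmx.
Qed.

Lemma opnorm_eq0 m n (A : 'M[R]_(m, n)) : opnorm A = 0 -> A = 0.
Proof.
move=> A0; apply/matrixP => i j.
have /eqP : enorm (A *m (delta_mx j 0 : 'cV_n)) = 0.
  by apply/le_anti; rewrite enorm_ge0 (le_trans (enorm_mulmx _ _))// A0 mul0r.
by rewrite enorm_eq0 -colE => /eqP /matrixP /(_ i 0); rewrite !mxE.
Qed.

Lemma opnorm_idempotent n (A : 'M[R]_n) : A *m A = A -> A != 0 -> 1 <= opnorm A.
Proof.
move=> AA A0; have N0 : 0 < opnorm A.
  rewrite lt_neqAle opnorm_ge0 andbT eq_sym.
  by apply: contra A0 => /eqP /opnorm_eq0 ->.
by rewrite -(ler_pM2l N0) mulr1 -{1}AA opnorm_mulmx.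
Qed.

(* If [N^2 - A^T A], which is positive semidefinite for [N = opnorm A], were
   invertible, Cauchy-Schwarz would make it bounded below by some [1/K > 0],
   so that [N^2 - 1/K] would bound [|A v|^2] on the unit ball. *)
Lemma opnorm_eigenvalue n (A : 'M[R]_n) : (0 < n)%N ->
  eigenvalue (A^T *m A) (opnorm A ^+ 2).
Proof.
case: n A => // n A _; set N := opnorm A.
have [//|noteig] := boolP (eigenvalue _ _); exfalso.
pose B := (N ^+ 2)%:M - A^T *m A.
have Bunit : B \in unitmx.
  (* [eigenvalue] means that the kernel of [A^T *m A - (N ^+ 2)%:M] is nonzero, hence the change of
     sign. *)
  rewrite /B -opprB -scaleN1r unitmxZ ?unitrN1// -row_free_unit -kermx_eq0.
  by apply/negPn; exact: noteig.
have qB v : dotv v (B *m v) = N ^+ 2 * enorm v ^+ 2 - enorm (A *m v) ^+ 2.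
  rewrite mulmxBl mul_scalar_mx dotvDr dotvZr dotvNr !sqr_enorm.
  by rewrite dotv_mull mulmxA.
have Bpsd v : 0 <= dotv v (B *m v).
  rewrite qB -exprMn subr_ge0 ler_sqr ?enorm_mulmx//.
    by rewrite nnegrE enorm_ge0.
  by rewrite nnegrE mulr_ge0 ?enorm_ge0 ?opnorm_ge0.
have Bsym : B^T = B by rewrite linearB/= tr_scalar_mx trmx_mul trmxK.
have [K K0 BK] := enorm_mulmx_bounded (invmx B).
have coercive v : enorm (A *m v) ^+ 2 <= (N ^+ 2 - K^-1) * enorm v ^+ 2.
  rewrite mulrBl lerBrDr -lerBrDl -qB mulrC ler_pdivrMr//.
  have [->|v0] := eqVneq v 0.
    by rewrite mulmx0 enorm0 expr0n/= /dotv mulmx0 mxE mul0r.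
  have nv : 0 < enorm v ^+ 2 by rewrite exprn_even_gt0//= enorm_eq0.
  rewrite -(ler_pM2r nv).
  (* For the form of [B], at [v] and [invmx B *m v]: |v|^4 <= <v, B v> <B^-1 v, v> <= <v, B v> K
     |v|^2. *)
  have := cauchy_schwarz_psd v (invmx B *m v) Bsym Bpsd.
  rewrite mulKVmx// -sqr_enorm -expr2 => /le_trans; apply.
  rewrite -mulrA ler_wpM2l// (le_trans (cauchy_schwarz _ _))//.
  by rewrite expr2 mulrA ler_wpM2r ?enorm_ge0.
(* A unit vector, available because the size is positive, shows that the square root taken next is
   that of a nonnegative number. *)
have gap : 0 <= N ^+ 2 - K^-1.
  have := coercive (delta_mx 0 0); rewrite enorm_delta expr1n mulr1.
  by apply: le_trans; rewrite sqr_ge0.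
have : N <= Num.sqrt (N ^+ 2 - K^-1).
  apply: opnorm_le => [|v]; first exact: sqrtr_ge0.
  rewrite -ler_sqr ?nnegrE ?mulr_ge0 ?enorm_ge0 ?sqrtr_ge0//.
  by rewrite exprMn (sqr_sqrtr gap).
rewrite -ler_sqr ?nnegrE ?sqrtr_ge0 ?opnorm_ge0// sqr_sqrtr//.
by rewrite lerBrDr gerDl leNgt invr_gt0 K0.
Qed.

(** Eigenvectors are rows here: for an eigenvector [u] of [A^T *m A] with eigenvalue [a], a |u^T|^2
    = |A u^T|^2 <= |A|^2 |u^T|^2. *)
Lemma singular_value_le_opnorm n (A : 'M[R]_n) s :
  singular_values A s -> s <= opnorm A.
Proof.
move=> [a /= /eigenvalueP[u uA u0] <-].
rewrite -[leRHS]ger0_norm ?opnorm_ge0// -sqrtr_sqr ler_wsqrtr//.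
have nu : 0 < enorm u^T ^+ 2.
  by rewrite exprn_even_gt0//= enorm_eq0 trmx_eq0.
rewrite -(ler_pM2r nu) -exprMn sqr_enorm -dotvZl -linearZ/= -uA.
rewrite trmx_mul trmx_mul trmxK -mulmxA dotv_mull trmxK -sqr_enorm.
by rewrite ler_sqr ?nnegrE ?mulr_ge0 ?enorm_ge0 ?opnorm_ge0 ?enorm_mulmx.
Qed.

(** The operator norm is itself a singular value and bounds all the others, so the supremum is
    attained there. *)
Lemma sigma_maxE n (A : 'M[R]_n) : (0 < n)%N -> sigma_max A = opnorm A.
Proof.
move=> n0; have As : singular_values A (opnorm A).
  exists (opnorm A ^+ 2); first exact: opnorm_eigenvalue.
  by rewrite sqrtr_sqr ger0_norm ?opnorm_ge0.
apply/le_anti/andP; split.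
  apply: ge_sup => [|s]; first by exists (opnorm A).
  exact: singular_value_le_opnorm.
apply: ub_le_sup => //; exists (opnorm A) => s.
exact: singular_value_le_opnorm.
Qed.

End EuclideanNorm.

(** * Spectrum, singular values and quadratic forms of diagonal matrices *)

Section DiagonalMatrices.
Variable R : realType.

Lemma mul_diag_cV n (a : 'rV[R]_n) (v : 'cV[R]_n) i :
  (diag_mx a *m v) i 0 = a 0 i * v i 0.
Proof. by rewrite mul_diag_mx mxE. Qed.

Lemma invmx_diag n (a : 'rV[R]_n) : (forall i, a 0 i != 0) ->
  diag_mx a \in unitmx /\ invmx (diag_mx a) = diag_mx (\row_i (a 0 i)^-1).
Proof.
move=> a0; have aV : diag_mx a *m diag_mx (\row_i (a 0 i)^-1) = 1%:M.
  rewrite mulmx_diag -diag_const_mx; congr diag_mx.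
  by apply/rowP => i; rewrite !mxE mulfV.
have [aU _] := mulmx1_unit aV; split=> //.
by rewrite -[RHS](mulKmx aU) aV mulmx1.
Qed.

(** A nonzero coordinate of an eigenvector identifies its eigenvalue with a diagonal entry; unit
    rows give the converse. *)
Lemma eigenvalue_diag n (a : 'rV[R]_n) :
  [set b | eigenvalue (diag_mx a) b] = range (a 0).
Proof.
apply/seteqP; split => [b /= /eigenvalueP[u uE /rV0Pn[i ui]]|_ [i _ <-]].
  exists i => //; move/rowP : uE => /(_ i); rewrite mul_mx_diag !mxE mulrC.
  by move/(mulIf ui).
apply/eigenvalueP; exists (delta_mx 0 i).
  apply/rowP => j; rewrite mul_mx_diag !mxE eqxx/=.
  by have [->|] := eqVneq j i; rewrite ?mulr1 ?mul1r ?mul0r ?mulr0.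
by apply/rV0Pn; exists i; rewrite mxE !eqxx oner_neq0.
Qed.

Lemma singular_values_diag n (a : 'rV[R]_n) : (forall i, 0 <= a 0 i) ->
  singular_values (diag_mx a) = range (a 0).
Proof.
move=> a0; rewrite /singular_values tr_diag_mx mulmx_diag eigenvalue_diag.
rewrite image_comp/=; apply/seteqP; split => [_ [i _ <-]|_ [i _ <-]];
  by exists i => //=; rewrite mxE -expr2 sqrtr_sqr ger0_norm.
Qed.

Lemma inf_range_ord n (a : 'I_n -> R) i :
  (forall j, a i <= a j) -> inf (range a) = a i.
Proof.
move=> ai; apply/le_anti/andP; split.
  by apply: ge_inf; [exists (a i) => _ [j _ <-] | exists i].
by apply: lb_le_inf => [|_ [j _ <-]//]; exists (a i), i.
Qed.

Lemma sup_range_ord n (a : 'I_n -> R) i :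
  (forall j, a j <= a i) -> sup (range a) = a i.
Proof.
move=> ai; apply/le_anti/andP; split.
  by apply: ge_sup => [|_ [j _ <-]//]; exists (a i), i.
by apply: ub_le_sup; [exists (a i) => _ [j _ <-] | exists i].
Qed.

Lemma dotv_diag n (a : 'rV[R]_n) v :
  dotv v (diag_mx a *m v) = \sum_i a 0 i * v i 0 ^+ 2.
Proof. by rewrite dotvE; apply: eq_bigr => i _; rewrite mul_diag_cV; ring. Qed.

Lemma dotv_diag_ge n (a : 'rV[R]_n) c v : (forall i, c <= a 0 i) ->
  c * enorm v ^+ 2 <= dotv v (diag_mx a *m v).
Proof.
move=> ca; rewrite dotv_diag sqr_enorm dotvE mulr_sumr; apply: ler_sum => i _.
by rewrite -expr2 ler_wpM2r ?sqr_ge0.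
Qed.

Lemma dotv_diag_le n (a : 'rV[R]_n) c v : (forall i, a 0 i <= c) ->
  dotv v (diag_mx a *m v) <= c * enorm v ^+ 2.
Proof.
move=> ca; rewrite dotv_diag sqr_enorm dotvE mulr_sumr; apply: ler_sum => i _.
by rewrite -expr2 ler_wpM2r ?sqr_ge0.
Qed.

Lemma enorm_diag_ge n (a : 'rV[R]_n) c v : 0 <= c -> (forall i, c <= a 0 i) ->
  c * enorm v <= enorm (diag_mx a *m v).
Proof.
move=> c0 ca; rewrite -ler_sqr ?nnegrE ?mulr_ge0 ?enorm_ge0//.
rewrite exprMn !sqr_enorm !dotvE mulr_sumr; apply: ler_sum => i _.
rewrite mul_diag_cV -!expr2 exprMn ler_wpM2r ?sqr_ge0// ler_sqr// nnegrE//.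
exact: le_trans (ca i).
Qed.

End DiagonalMatrices.

(** * The weighted projection for a positive diagonal matrix *)

Section WeightedProjection.
Variables (R : realType) (m l : nat) (a : 'rV[R]_m) (E : 'M[R]_(m, l)).
Hypothesis a_gt0 : forall i, 0 < a 0 i.
Hypothesis rankE : \rank E^T = l.

Let D := diag_mx a.
Let S := E^T *m invmx D *m E.
Let A := mls_mx D E.

Let D_unit : D \in unitmx.
Proof. by apply: (invmx_diag _).1 => i; rewrite gt_eqF. Qed.

Let D_sym : D^T = D. Proof. exact: tr_diag_mx. Qed.

Let DV_sym : (invmx D)^T = invmx D. Proof. by rewrite trmx_inv D_sym. Qed.

(** If [v *m S = 0], then z = E v^T satisfies <z, D^-1 z> = 0, so z = 0 because the diagonal of D^-1
    is positive, and v = 0 because [E^T] has full row rank. *)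
Lemma normal_mx_unit : S \in unitmx.
Proof.
rewrite -row_free_unit; apply: inj_row_free => v vS.
have [_ DV] := invmx_diag (fun i => negbT (gt_eqF (a_gt0 i))).
suff /eqP : (v *m E^T)^T = 0.
  rewrite trmx_eq0 => /eqP vE; apply: (row_free_inj (A := E^T)).
    by rewrite /row_free rankE.
  by rewrite vE mul0mx.
apply/eqP; rewrite -dotv_eq0; apply/eqP.
have q0 : dotv (v *m E^T)^T (invmx D *m (v *m E^T)^T) = 0.
  rewrite /dotv trmxK trmx_mul trmxK.
  have -> : v *m E^T *m (invmx D *m (E *m v^T)) = v *m S *m v^T.
    by rewrite /S !mulmxA.
  by rewrite vS mul0mx mxE.
move: q0; rewrite DV dotv_diag => /eqP; rewrite psumr_eq0 => [/allP q0|i _].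
  rewrite dotvE big1// => i _; have := q0 i (mem_index_enum _).
  rewrite mulf_eq0 mxE invr_eq0 gt_eqF//= sqrf_eq0 => /eqP ->.
  by rewrite mulr0.
by rewrite mxE mulr_ge0 ?sqr_ge0// invr_ge0 ltW.
Qed.

Lemma mls_mx_idempotent : A *m A = A.
Proof.
have -> : A *m A = invmx D *m E *m (invmx S *m S) *m invmx S *m E^T.
  by rewrite /A /mls_mx /S !mulmxA.
by rewrite mulVmx ?normal_mx_unit// mulmx1.
Qed.

(** Serves to exclude [A = 0], which would force [E^T = 0] and hence rank 0. *)
Lemma tr_mul_mls_mx : E^T *m A = E^T.
Proof.
have -> : E^T *m A = S *m invmx S *m E^T by rewrite /A /mls_mx /S !mulmxA.
by rewrite mulmxV ?normal_mx_unit// mul1mx.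
Qed.

(** Both sides reduce to E S^-1 E^T. As [D] is symmetric, this says that [A] is self-adjoint for <u,
    D v>. *)
Lemma mls_mx_adjoint : D *m A = A^T *m D.
Proof.
have S_sym : S^T = S by rewrite /S !trmx_mul trmxK DV_sym mulmxA.
rewrite /A /mls_mx -/S !trmx_mul trmxK trmx_inv S_sym DV_sym.
by rewrite !mulmxA mulmxV// mul1mx -!mulmxA mulVmx// mulmx1 !mulmxA.
Qed.

(* [A] is the orthogonal projection onto its range for the scalar product
   [<u, D v>]. *)
Lemma mls_mx_pythagoras v w :
  dotv (A *m v) (D *m (A *m w)) = dotv v (D *m (A *m w)).
Proof.
rewrite dotv_mull [A^T *m _]mulmxA -mls_mx_adjoint -[in RHS]mls_mx_idempotent.
by rewrite !mulmxA.
Qed.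

Lemma opnorm_mls_mx_inv_le c : 0 < c -> (forall i, c <= a 0 i) ->
  opnorm (A *m invmx D) <= c^-1.
Proof.
move=> c0 ca; apply: opnorm_le => [|v]; first by rewrite invr_ge0 ltW.
rewrite -mulmxA; set w := invmx D *m v; set y := A *m w.
rewrite mulrC ler_pdivlMr// mulrC.
have [->|y0] := eqVneq y 0; first by rewrite enorm0 mulr0 enorm_ge0.
have ny : 0 < enorm y by rewrite lt_neqAle enorm_ge0 eq_sym enorm_eq0 y0.
rewrite -(ler_pM2r ny) -mulrA -expr2 (le_trans (dotv_diag_ge _ ca))//.
(* The projection identity turns <y, D y> into <w, D y>; then [D] moves to the left, where
   [D *m w = v]. *)
have <- : dotv v y = dotv y (D *m y).
  by rewrite mls_mx_pythagoras -{1}(mulKVmx D_unit v) dotv_mull D_sym.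
by rewrite cauchy_schwarz.
Qed.

Lemma opnorm_mls_mx_le c C : 0 < c -> (forall i, c <= a 0 i <= C) -> 0 <= C ->
  opnorm A <= Num.sqrt (C / c).
Proof.
move=> c0 caC C0; have Cc : 0 <= C / c by rewrite divr_ge0 ?(ltW c0).
apply: opnorm_le => [|v]; first exact: sqrtr_ge0.
rewrite -ler_sqr ?nnegrE ?mulr_ge0 ?enorm_ge0 ?sqrtr_ge0//.
rewrite exprMn (sqr_sqrtr Cc) mulrAC ler_pdivlMr// mulrC.
have ca i : c <= a 0 i by case/andP: (caC i).
have aC i : a 0 i <= C by case/andP: (caC i).
rewrite (le_trans (dotv_diag_ge _ ca))// (le_trans _ (dotv_diag_le _ aC))//.
(* The form of [D] at the complementary component [v - A *m v] equals <v, D v> - <A v, D A v>, so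
   projecting does not increase it. *)
have : 0 <= dotv (v - A *m v) (D *m (v - A *m v)).
  apply: le_trans (dotv_diag_ge _ (fun i => ltW (a_gt0 i))).
  by rewrite mul0r.
have AvDv : dotv (A *m v) (D *m v) = dotv v (D *m (A *m v)).
  by rewrite dotvC dotv_mull D_sym.
rewrite mulmxBr dotvDr dotvNr !dotvBl mls_mx_pythagoras AvDv subrr subr0.
by rewrite subr_ge0.
Qed.

End WeightedProjection.

(** * The three inequalities for the weight matrix *)

(** With B = [diag_mx b] and v = B (B^-1 v), |A v| <= |A B| |B^-1 v|, and |B^-1 v| <= |v| / c
    because B stretches every vector by at least [c]. *)
Lemma opnorm_mul_diag_ge (R : realType) m n (A : 'M[R]_(m, n)) (b : 'rV[R]_n)
    c :
  0 < c -> (forall i, c <= b 0 i) -> opnorm A * c <= opnorm (A *m diag_mx b).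
Proof.
move=> c0 cb; have bU : diag_mx b \in unitmx.
  by apply: (invmx_diag _).1 => i; rewrite gt_eqF// (lt_le_trans c0).
rewrite -ler_pdivlMr//; apply: opnorm_le => [|v].
  by rewrite divr_ge0 ?opnorm_ge0 ?(ltW c0).
rewrite -{1}(mulKVmx bU v) (mulmxA A) (le_trans (enorm_mulmx _ _))//.
rewrite -mulrA ler_wpM2l ?opnorm_ge0// mulrC ler_pdivlMr// mulrC.
by rewrite (le_trans (enorm_diag_ge _ (ltW c0) cb))// mulKVmx.
Qed.

Lemma weight_mxE (R : realType) d m (w : R -> R)
    (xs : 'I_m -> 'cV[R]_d) (x : 'cV[R]_d) :
  weight_mx w xs x = diag_mx (\row_i (2 * w (enorm (x - xs i)))).
Proof.
by rewrite /weight_mx -linearZ/=; congr diag_mx; apply/rowP => i; rewrite !mxE.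
Qed.

Lemma inverse_weight_gt0 (R : realType) (W : R -> \bar R) r :
  weight_function W -> 0 < r -> 0 < inverse_weight W r.
Proof.
by move=> [hW _] r0; rewrite /inverse_weight r0/= invr_gt0 fine_gt0// hW.
Qed.

Theorem lemma2p5 (R : realType) (d m l : nat)
    (Omega : set 'cV[R]_d) (hOmega : bounded_domain Omega)
    (xs : 'I_m -> 'cV[R]_d) (hxs : forall i, Omega (xs i))
    (xs_inj : injective xs)
    (p : 'I_l -> 'cV[R]_d -> R)
    (p_cont : forall j, {within Omega, continuous (p j)})
    (p_free : lin_indep_on Omega p)
    (p_one : in_span_on Omega p (fun=> 1))
    (l_gt0 : (1 <= l)%N) (l_le_m : (l <= m)%N)
    (rankE : \rank (sample_mx p xs)^T = l)
    (W : R -> \bar R) (hW : weight_function W)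
    (w_smooth : smooth_nonneg (inverse_weight W))
    (x : 'cV[R]_d) (hx : Omega x) (x_neq : forall i, x <> xs i) :
  let E := sample_mx p xs in
  let D := weight_mx (inverse_weight W) xs x in
  let A1 := mls_mx D E in
  [/\ opnorm (A1 *m invmx D) <= 1 / lambda_min D,
      sigma_max A1 * sigma_min (invmx D) <= sigma_max (A1 *m invmx D)
    & 1 <= opnorm A1 <= Num.sqrt (sigma_max D / sigma_min D)].
Proof.
move=> E D A1; rewrite -/E in rankE.
have m0 : (0 < m)%N by exact: leq_trans l_le_m.
pose a : 'rV[R]_m := \row_i (2 * inverse_weight W (enorm (x - xs i))).
have DE : D = diag_mx a by exact: weight_mxE.
have a0 i : 0 < a 0 i.
  (* [x] differs from every node, so only values of the inverse weight at positive distances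
     occur. *)
  rewrite mxE mulr_gt0// inverse_weight_gt0// lt_neqAle enorm_ge0 andbT eq_sym.
  by rewrite enorm_eq0 subr_eq0; apply/eqP.
(* Since [m] is positive, the diagonal of [D] attains its minimum at some [i0] and its maximum at
   some [i1]; these entries are the extreme spectral values. *)
have [i0 amin] : exists i, forall j, a 0 i <= a 0 j.
  case: (arg_minP (a 0) (erefl : predT (Ordinal m0))) => i _ h.
  by exists i => j; exact: h.
have [i1 amax] : exists i, forall j, a 0 j <= a 0 i.
  case: (arg_maxP (a 0) (erefl : predT (Ordinal m0))) => i _ h.
  by exists i => j; exact: h.
have [_ DV] := invmx_diag (fun i => negbT (gt_eqF (a0 i))).
have lminE : lambda_min D = a 0 i0.
  by rewrite /lambda_min DE eigenvalue_diag; exact: inf_range_ord.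
have sminE : sigma_min D = a 0 i0.
  rewrite /sigma_min DE singular_values_diag => [|i]; last exact: ltW.
  exact: inf_range_ord.
have smaxE : sigma_max D = a 0 i1.
  rewrite /sigma_max DE singular_values_diag => [|i]; last exact: ltW.
  exact: sup_range_ord.
pose aV : 'rV[R]_m := \row_i (a 0 i)^-1.
have aVE j : aV 0 j = (a 0 j)^-1 by rewrite [LHS]mxE.
(* Inversion reverses the order: the largest entry of [D] gives the smallest singular value of its
   inverse. *)
have aVmin j : aV 0 i1 <= aV 0 j by rewrite !aVE lef_pV2 ?posrE.
have sminVE : sigma_min (invmx D) = (a 0 i1)^-1.
  rewrite -aVE /sigma_min DE DV singular_values_diag => [|i].
    exact: inf_range_ord.
  by rewrite aVE invr_ge0 ltW.
split.
- rewrite lminE div1r /A1 DE; exact: opnorm_mls_mx_inv_le.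
- rewrite !sigma_maxE// sminVE -aVE DE DV.
  by apply: opnorm_mul_diag_ge => //; rewrite aVE invr_gt0.
- apply/andP; split.
    apply: opnorm_idempotent; first by rewrite /A1 DE mls_mx_idempotent.
    apply: contraTneq l_gt0 => A0.
    have := tr_mul_mls_mx a0 rankE; rewrite -DE -/A1 A0 mulmx0 => E0.
    by rewrite -rankE -E0 mxrank0.
  rewrite smaxE sminE /A1 DE; apply: opnorm_mls_mx_le => // [i|].
    by rewrite amin amax.
  exact: ltW.
Qed.
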